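(* Every cubic graph of order at most $10$ is characterized by its alliance polynomial; that is, if $G$ is a cubic graph of order at most $10$ and $G'$ is any graph with $A(G';x)=A(G;x)$, then $G'$ is isomorphic to $G$.
   Context: Graphs are finite, simple, nonempty, and not necessarily connected; the order is the number of vertices. A cubic graph is a $3$-regular graph (not necessarily connected). For a graph $G=(V,E)$ with order $n$ and maximum degree $\Delta$, and $X\subseteq V$, $\delta_X(v)$ is the number of neighbours of $v$ in $X$, $\overline{X}=V\setminus X$, and $\langle X\rangle$ is the induced subgraph. For a nonempty $S\subseteq V$ with $\langle S\rangle$ connected, and an integer $k\in[-\Delta,\Delta]$, $S$ is a defensive $k$-alliance if $\delta_S(v)\ge\delta_{\overline S}(v)+k$ for every $v\in S$; the exact index of alliance of $S$ is $k_S=\max\{k\in[-\Delta,\Delta]\cap\mathbb Z: S\text{ is a defensive }k\text{-alliance}\}=\min_{v\in S}\{\delta_S(v)-\delta_{\overline S}(v)\}$, and $S$ is called an exact defensive $k_S$-alliance. $A_k(G)$ denotes the number of exact defensive $k$-alliances in $G$ (subsets $S\subseteq V$), and the alliance polynomial of $G$ is $A(G;x)=\sum_{k=-\Delta}^{\Delta}A_k(G)\,x^{n+k}$ (where $n$ and $\Delta$ are the order and maximum degree of the graph in question). *)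

(* Defs.v *)
From HB Require Import structures.
From mathcomp Require Import all_boot all_order all_algebra.

Set Implicit Arguments.
Unset Strict Implicit.
Unset Printing Implicit Defensive.

Import Order.TTheory GRing.Theory Num.Theory.
Local Open Scope ring_scope.

Record sgraph := SGraph {
  vertex :> finType;
  adj : rel vertex;
  adj_sym : symmetric adj;
  adj_irrefl : irreflexive adj;
  vertex_gt0 : (0 < #|vertex|)%N }.

Definition isomorphic (G H : sgraph) : Prop :=
  exists f : G -> H, bijective f /\ forall u v : G, adj (f u) (f v) = adj u v.

Section Alliances.
Variable G : sgraph.
Implicit Types (v : G) (S : {set G}) (k : int).

Definition graph_order : nat := #|G|.

Definition degree_in S v : nat := #|[set u in S | adj v u]|.

Definition degree v : nat := degree_in setT v.

Definition max_degree : nat := \max_(v : G) degree v.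

Definition cubic : Prop := forall v, degree v = 3%N.

Definition induced S : rel G := [rel u v | [&& u \in S, v \in S & adj u v]].

Definition induced_connected S : bool :=
  [forall u in S, forall v in S, connect (induced S) u v].

(* The integers of [-Delta, Delta], listed as i - Delta for i < 2 * Delta + 1. *)
Definition index_of (i : 'I_(2 * max_degree).+1) : int :=
  i%:Z - max_degree%:Z.

Definition defensive_alliance k S : bool :=
  [&& S != set0, induced_connected S,
      - max_degree%:Z <= k <= max_degree%:Z &
      [forall v in S, (degree_in S v)%:Z >= (degree_in (~: S) v)%:Z + k]].

Definition exact_alliance k S : bool :=
  defensive_alliance k S &&
  [forall i, defensive_alliance (index_of i) S ==> (index_of i <= k)].

Definition num_exact_alliances k : nat :=
  #|[set S : {set G} | exact_alliance k S]|.

(* Since Delta < graph_order, the exponent is nonnegative and [absz] is only a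
   cast to nat. *)
Definition alliance_poly : {poly int} :=
  \sum_(i < (2 * max_degree).+1)
    (num_exact_alliances (index_of i))%:R *: 'X^(absz (graph_order%:Z + index_of i)).

End Alliances.

(* Main.v *)
(* For a cubic graph G of order n, comparing the lowest terms of A(G) and A(G')
   shows that G' has order n + m, maximum degree m + 3, and exactly n vertices of
   that degree; all exact indices in G' are at most 3 - m and congruent to m + 1
   modulo 2.

   If m > 0, let x have maximum degree, C be its component, w in C of minimum
   degree, and D the component of x in G' - w.  The bounds on the indices force G'
   to be connected and both C and D to have the exact index 3 - m, so A_3(G) >= 2
   and G is disconnected.  But a connected graph of order N having a vertex of
   degree at least 4 has at least 5 + N(N+1)/2 connected vertex sets, and
   disconnected cubic graphs of order n <= 10 have fewer than 5 + (n+1)(n+2)/2,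
   while the number of connected sets is A(G;1) = A(G';1).

   So G' is cubic of order n, and an exhaustive enumeration of cubic graphs shows
   that A(G;1) alone separates the isomorphism classes of a given order n <= 10. *)
Require Import Defs.
From mathcomp Require Import all_boot all_order all_algebra zify.

Set Implicit Arguments.
Unset Strict Implicit.
Unset Printing Implicit Defensive.

Import Order.TTheory GRing.Theory Num.Theory.

(** * Counting connected vertex sets by computation *)

Fixpoint bitseqs n : seq bitseq :=
  if n is n'.+1 then
    [seq false :: b | b <- bitseqs n'] ++ [seq true :: b | b <- bitseqs n']
  else [:: [::]].

Lemma mem_bitseqs n b : (b \in bitseqs n) = (size b == n).
Proof.
elim: n b => [|n IHn] [|[] b] //=; rewrite mem_cat.
- by apply/norP; split; apply/mapP => -[].
- rewrite eqSS -IHn [X in X || _](_ : _ = false); last by apply/mapP => -[].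
  by rewrite mem_map // => ? ? [].
rewrite eqSS -IHn orbC [X in X || _](_ : _ = false); last by apply/mapP => -[].
by rewrite mem_map // => ? ? [].
Qed.

Lemma bitseqs_uniq n : uniq (bitseqs n).
Proof.
elim: n => //= n IHn; rewrite cat_uniq !map_inj_uniq ?IHn ?andbT;
  try by move=> ? ? [].
by apply/hasPn => _ /mapP[b _ ->]; apply/mapP => -[].
Qed.

Lemma mask_inj (T : eqType) (s : seq T) b1 b2 :
    uniq s -> size b1 = size s -> size b2 = size s ->
  mask b1 s =i mask b2 s -> b1 = b2.
Proof.
move=> s_uniq sz1 sz2 eq_b; apply: (@eq_from_nth _ false); first by rewrite sz1.
move=> i lt_i; rewrite sz1 in lt_i; case: s s_uniq sz1 sz2 eq_b lt_i => // x s.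
move=> s_uniq sz1 sz2 eq_b lt_i; move: (eq_b (nth x (x :: s) i)).
by rewrite !in_mask // index_uniq // mem_nth.
Qed.

Lemma mem_uniq_full (T : finType) (s : seq T) :
  uniq s -> size s = #|T| -> forall x, x \in s.
Proof.
move=> s_uniq sz_s x; suff /(_ x)-> : s =i predT by [].
by apply/subset_cardP; [rewrite (card_uniqP s_uniq) | apply/subsetP].
Qed.

(** Replaces the sets of vertices by bit sequences along a numbering [s], so that the count can be
    evaluated by computation. *)
Lemma card_sets_mask (T : finType) (s : seq T) (P : pred {set T}) :
    uniq s -> size s = #|T| ->
  #|[set S | P S]| = count (fun b => P [set x in mask b s]) (bitseqs (size s)).
Proof.
move=> s_uniq sz_s.
have s_all := mem_uniq_full s_uniq sz_s.
rewrite -size_filter cardE -(size_map (fun b => [set x in mask b s])).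
apply/perm_size/uniq_perm; first exact: enum_uniq.
  rewrite map_inj_in_uniq ?filter_uniq ?bitseqs_uniq // => b1 b2.
  rewrite !mem_filter !mem_bitseqs => /andP[_ /eqP sz1] /andP[_ /eqP sz2] eq_b.
  apply: (mask_inj s_uniq) => // x; move/setP/(_ x): eq_b; by rewrite !inE.
move=> S; rewrite mem_enum inE.
apply/idP/mapP => [PS|[b]]; last by rewrite mem_filter => /andP[Pb _] ->.
have defS : S = [set x in mask [seq x \in S | x <- s] s].
  by apply/setP => x; rewrite inE -filter_mask mem_filter s_all andbT.
exists [seq x \in S | x <- s] => //.
by rewrite mem_filter -defS PS mem_bitseqs size_map /=.
Qed.

(* Breadth-first search: [A] is the last layer and [S] the unvisited vertices;
   the test is whether all of [S] gets visited. *)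
Fixpoint reaches (T : Type) (e : rel T) (fuel : nat) (A S : seq T) : bool :=
  if fuel is f.+1 then
    let next v := has (fun u => e u v) A in
    if filter next S is [::] then nilp S
    else reaches e f (filter next S) (filter (predC next) S)
  else nilp S.

Definition connected_seq (T : Type) (e : rel T) (s : seq T) : bool :=
  if s is x :: s' then reaches e (size s') [:: x] s' else false.

Lemma reaches_map (T U : eqType) (f : T -> U) (e : rel T) (e' : rel U) n A S :
    {in A ++ S &, forall x y, e' (f x) (f y) = e x y} ->
  reaches e' n (map f A) (map f S) = reaches e n A S.
Proof.
elim: n A S => [|n IHn] A S eqe /=; first by rewrite /nilp size_map.
have eq_next : {in S, forall v, has (fun u => e' u (f v)) (map f A)
                              = has (fun u => e u v) A}.
  move=> v Sv; rewrite has_map; apply: eq_in_has => u Au /=.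
  by rewrite eqe ?mem_cat ?Au ?Sv ?orbT.
set next' := fun v => has (fun u => e' u v) _.
set next := fun v => has (fun u => e u v) _.
have eqF : filter next' (map f S) = map f (filter next S).
  by rewrite filter_map; congr map; apply: eq_in_filter => v /eq_next.
have eqC : filter (predC next') (map f S) = map f (filter (predC next) S).
  rewrite filter_map; congr map; apply: eq_in_filter => v /eq_next /= eqv.
  by congr (~~ _).
rewrite eqF eqC /nilp size_map -/(nilp S) -(IHn (filter next S)); first by case: filter.
move=> x y; rewrite !mem_cat !mem_filter => xP yP; apply: eqe; rewrite mem_cat.
  by case/orP: xP => /andP[_ ->]; rewrite orbT.
by case/orP: yP => /andP[_ ->]; rewrite orbT.
Qed.

Lemma connected_seq_map (T U : eqType) (f : T -> U) (e : rel T) (e' : rel U) s :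
    {in s &, forall x y, e' (f x) (f y) = e x y} ->
  connected_seq e' (map f s) = connected_seq e s.
Proof.
case: s => //= x s eqe; rewrite size_map.
exact: (@reaches_map _ _ f e e' _ [:: x] s eqe).
Qed.

(** Every round that does not end the search removes a vertex from [S], so fuel [size S] suffices.
    Paths start in [A] and then run through unvisited vertices only. *)
Lemma reachesP (T : finType) (e : rel T) n (A S : seq T) :
    size S <= n -> ~~ has (mem A) S ->
  reflect {in S, forall v, exists2 u, u \in A
                                & connect [rel x y | e x y && (y \in S)] u v}
          (reaches e n A S).
Proof.
elim: n A S => [|n IHn] A S /=.
  by rewrite leqn0 => /nilP-> _; apply: (iffP idP).
move=> leSn disjAS; set next := fun v => has (fun u => e u v) A.
set N := filter next S; set S' := filter (predC next) S.
have [N0|N_neq0] := eqVneq N [::].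
  rewrite N0; apply: (iffP nilP) => [-> //|reachS]; apply/eqP/negPn/negP.
  case defS: S => [//|v S2] _; have Sv : v \in S by rewrite defS mem_head.
  have [u Au /connectP[[|y p] /= ]] := reachS v Sv.
    by move=> _ defv; move/hasPn/(_ v Sv): disjAS; rewrite defv /= Au.
  case/andP => /andP[euy Sy] _ _.
  have : y \in N by rewrite mem_filter Sy andbT; apply/hasP; exists u.
  by rewrite N0.
have -> : (if N is [::] then nilp S else reaches e n N S') = reaches e n N S'.
  by case: (N) N_neq0.
have szS' : size S' <= n.
  rewrite -ltnS; apply: leq_trans leSn.
  rewrite -(count_predC next S) -!size_filter -/N -/S' -[X in X < _]add0n.
  by rewrite ltn_add2r lt0n size_eq0.
have disjNS' : ~~ has (mem N) S'.
  by apply/hasPn => v; rewrite mem_filter /= mem_filter => /andP[/negPf->].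
apply: (iffP (IHn _ _ szS' disjNS')) => reachS v.
  move=> Sv; have [nv|nnv] := boolP (next v).
    by have /hasP[u Au euv] := nv; exists u => //; apply: connect1; rewrite /= euv.
  have [|u] := reachS v; first by rewrite mem_filter /= nnv.
  rewrite mem_filter => /andP[/hasP[z Az ezu] Su] con; exists z => //.
  apply: connect_trans (_ : connect _ u v); first by apply: connect1; rewrite /= ezu.
  apply: connect_sub con => y t /= /andP[eyt]; rewrite mem_filter => /andP[_ St].
  by apply: connect1; rewrite /= eyt.
move=> S'v; have Sv : v \in S by move: S'v; rewrite mem_filter => /andP[].
have [u Au /connectP[p]] := reachS v Sv.
(* Cut the path at its last vertex in the new layer [N]: from there on it stays in [S']. Without
   such a vertex its start lies in [S'] too, which is impossible for a start in [A]. *)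
have key : forall z, z \in A ++ S -> path [rel x y | e x y && (y \in S)] z p ->
     v = last z p ->
     (exists2 w, w \in N & connect [rel x y | e x y && (y \in S')] w v) \/
     (z \in S' /\ connect [rel x y | e x y && (y \in S')] z v).
  elim: p => [|y p IHp] z zAS /= ; first by move=> _ <-; right.
  case/andP => /andP[ezy Sy] yp lastv.
  have yAS : y \in A ++ S by rewrite mem_cat Sy orbT.
  have [|[S'y con]] := IHp y yAS yp lastv; first by left.
  have con' : connect [rel x y | e x y && (y \in S')] z v.
    by apply: connect_trans con; apply: connect1; rewrite /= ezy.
  have [Az|nAz] := boolP (z \in A).
    move: S'y; rewrite mem_filter /= => /andP[/hasPn/(_ z Az)]; by rewrite ezy.
  have Sz : z \in S by move: zAS; rewrite mem_cat (negPf nAz).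
  have [nz|nnz] := boolP (next z).
    by left; exists z; rewrite // mem_filter nz.
  by right; rewrite mem_filter /= nnz.
move=> up lastv; have uAS : u \in A ++ S by rewrite mem_cat Au.
have [//|[]] := key u uAS up lastv.
by rewrite mem_filter => /andP[_]; move/hasPn: disjAS => H /H /=; rewrite Au.
Qed.

(** These are the sets that have an exact index of alliance. *)
Definition cset (G : sgraph) (S : {set G}) : bool :=
  (S != set0) && induced_connected S.

Lemma induced_sym (G : sgraph) (S : {set G}) : symmetric (induced S).
Proof.
by move=> u v; rewrite /induced /= adj_sym; case: (u \in S); case: (v \in S).
Qed.

Lemma induced_connect_sym (G : sgraph) (S : {set G}) : connect_sym (induced S).
Proof. exact/sym_connect_sym/induced_sym. Qed.

Lemma csetP (G : sgraph) (S : {set G}) x : x \in S ->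
  reflect {in S, forall v, connect (induced S) x v} (cset S).
Proof.
move=> Sx; have -> : cset S = induced_connected S.
  by rewrite /cset; case: eqP Sx => // ->; rewrite inE.
apply: (iffP forall_inP) => [/(_ x Sx)/forall_inP // | con u Su].
apply/forall_inP => v Sv; apply: connect_trans (con v Sv).
by rewrite induced_connect_sym con.
Qed.

Lemma connected_seqE (G : sgraph) (s : seq G) :
  uniq s -> connected_seq (@adj G) s = cset [set x in s].
Proof.
case: s => [_|x s /= /andP[xs s_uniq]].
  have -> : [set x in [::]] = set0 :> {set G} by apply/setP => y; rewrite !inE.
  by rewrite /cset eqxx.
have disj : ~~ has (mem [:: x]) s.
  by apply/hasPn => y sy; rewrite /= inE; apply: contra xs => /eqP<-.
have Sx : x \in [set y in x :: s] by rewrite inE mem_head.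
apply/(reachesP _ (leqnn _) disj)/(csetP Sx) => con v.
  rewrite !inE => /predU1P[->|sv]; first exact: connect0.
  have [u] := con v sv; rewrite inE => /eqP -> /connectP[p xp ->].
  have ind q z : z \in x :: s -> path [rel u v | adj u v && (v \in s)] z q ->
      path (induced [set y in x :: s]) z q.
    elim: q z => //= y q IHq z zxs /andP[/andP[ezy sy] yq].
    have xsy : y \in x :: s by rewrite in_cons sy orbT.
    rewrite (IHq y xsy yq) andbT /induced /=. by rewrite !in_set zxs ezy xsy.
  by apply/connectP; exists p => //; apply: ind xp; apply: mem_head.
move=> sv; exists x; rewrite ?mem_head //.
have /connectP[p xp ->] : connect (induced [set y in x :: s]) x v.
  by apply: con; rewrite !inE sv orbT.
(* A path without repetitions never returns to [x], so after its start it stays in [s]. *)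
case/shortenP: xp => p' xp' /= /andP[xp'N _] _.
apply/connectP; exists p' => //.
have ind q z : x \notin q -> path (induced [set y in x :: s]) z q ->
    path [rel u v | adj u v && (v \in s)] z q.
  elim: q z => //= y q IHq z; rewrite in_cons negb_or => /andP[xy xq].
  case/andP=> /and3P[_ + ->] yq; rewrite !inE eq_sym (negPf xy) /= => ->.
  exact: IHq.
exact: ind xp'N xp'.
Qed.

(** * Enumeration of cubic graphs *)

(* Adjacency matrices of graphs on [{0, ..., n - 1}], as lists of rows. *)
Notation table := (seq bitseq).

Definition edge (g : table) : rel nat := fun i j => nth false (nth [::] g i) j.

(** [s] is the numbering. The default [x0] is never reached, as [i] and [j] are below the length of
    [s]. *)
Definition tabulates (G : sgraph) (n : nat) (g : table) (s : seq G) : Prop :=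
  [/\ uniq s, size s = #|G|, size s = n &
      forall x0 i j, i < n -> j < n ->
        adj (nth x0 s i) (nth x0 s j) = edge g i j].

Lemma connected_seq_mask (G : sgraph) n (g : table) (s : seq G) b :
    tabulates n g s ->
  cset [set x in mask b s] = connected_seq (edge g) (mask b (iota 0 n)).
Proof.
case=> s_uniq _ sz_s adj_s; rewrite -connected_seqE ?mask_uniq //.
case: s => [|x0 s'] in s_uniq sz_s adj_s *; first by rewrite -sz_s /= !mask0.
have {1}-> : x0 :: s' = map (nth x0 (x0 :: s')) (iota 0 n).
  by rewrite -sz_s map_nth_iota0 // take_size.
rewrite -map_mask; apply: connected_seq_map => i j /mem_mask + /mem_mask.
by rewrite !mem_iota => /andP[_ lti] /andP[_ ltj]; apply: adj_s.
Qed.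

Definition num_connected (n : nat) (g : table) : nat :=
  count (fun b => connected_seq (edge g) (mask b (iota 0 n))) (bitseqs n).

Lemma card_csets (G : sgraph) n (g : table) (s : seq G) :
  tabulates n g s -> #|[set S : {set G} | cset S]| = num_connected n g.
Proof.
move=> tab; have [s_uniq sz_s sz_n _] := tab.
rewrite (card_sets_mask _ s_uniq sz_s) sz_n; apply: eq_count => b /=.
exact: connected_seq_mask tab.
Qed.

Lemma connected_table (G : sgraph) n (g : table) (s : seq G) :
  tabulates n g s -> cset [set: G] = connected_seq (edge g) (iota 0 n).
Proof.
move=> tab; have [s_uniq sz_s sz_n _] := tab.
have := connected_seq_mask (nseq n true) tab.
rewrite !mask_true ?size_iota ?sz_n // => <-; congr cset.
by apply/setP=> x; rewrite !inE mem_uniq_full.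
Qed.

Lemma tabulates_isomorphic (G H : sgraph) n (g : table) (s : seq G) (t : seq H) :
  tabulates n g s -> tabulates n g t -> isomorphic G H.
Proof.
move=> [s_uniq sz_sG sz_s adj_s] [t_uniq sz_tH sz_t adj_t].
have sP := mem_uniq_full s_uniq sz_sG.
have tP := mem_uniq_full t_uniq sz_tH.
have /card_gt0P[x0 _] := vertex_gt0 G; have /card_gt0P[y0 _] := vertex_gt0 H.
have lts x : index x s < n by rewrite -sz_s index_mem.
have ltt x : index x t < n by rewrite -sz_t index_mem.
exists (fun x => nth y0 t (index x s)); split.
  exists (fun y => nth x0 s (index y t)) => x.
    by rewrite index_uniq ?nth_index // sz_t.
  by rewrite index_uniq ?nth_index // sz_s.
by move=> u v; rewrite adj_t // -(adj_s x0) // !nth_index.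
Qed.

(* Every cubic graph can be numbered so that each vertex in turn, when its row is
   written, sends its edges to unnumbered vertices to the next free numbers.  So
   [g] holds the rows written so far, [m] numbers are in use, [ahead] gives the
   entries of the new row between the diagonal and [m], and the [t] missing
   neighbours receive the numbers from [m] on. *)
Fixpoint tables (n fuel m : nat) (g : table) : seq table :=
  if fuel is f.+1 then
    let i := size g in
    let m := maxn m i.+1 in
    let back := [seq edge g j i | j <- iota 0 i] in
    flatten [seq
      (let old := back ++ false :: ahead in
       let t := 3 - count id old in
       if (count id old <= 3) && (m + t <= n) then
         tables n f (m + t)
           (rcons g (old ++ nseq t true ++ nseq (n - (m + t)) false))
       else [::])
      | ahead <- bitseqs (m - i.+1)]
  else [:: g].

(** State of the enumeration when the vertices of [s] are numbered and the rows of those in [p] are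
    written; the remaining columns are padded with [false]. *)
Definition partial_table (G : sgraph) (s p : seq G) : table :=
  [seq [seq adj v u | u <- s] ++ nseq (#|G| - size s) false | v <- p].

(** All neighbours of [p] are in [s], so the columns of [t] hold only [false] and agree with the
    padding. *)
Lemma partial_table_cat (G : sgraph) (s t p : seq G) :
    uniq (s ++ t) -> (forall v, v \in p -> forall u, adj v u -> u \in s) ->
  partial_table (s ++ t) p = partial_table s p.
Proof.
move=> st_uniq closed; apply/eq_in_map => v pv.
rewrite map_cat -catA; congr (_ ++ _).
have -> : [seq adj v u | u <- t] = nseq (size t) false.
  rewrite -(size_map (adj v)); apply/all_pred1P/allP => _ /mapP[u tu ->] /=.
  apply/eqP/negP => /(closed v pv) su.
  by move: st_uniq; rewrite cat_uniq => /and3P[_ /hasPn/(_ u tu)/=]; rewrite su.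
rewrite -nseqD; congr nseq.
have: size (s ++ t) <= #|G| by rewrite -(card_uniqP st_uniq) max_card.
by rewrite size_cat; lia.
Qed.

(** By symmetry the column of [v] in the written rows is the start of its own row: the list [back]
    of [tables]. *)
Lemma partial_table_edge (G : sgraph) (p q : seq G) v :
  [seq edge (partial_table (p ++ v :: q) p) j (size p) | j <- iota 0 (size p)] =
  [seq adj v u | u <- p].
Proof.
apply: (@eq_from_nth _ false) => [|i]; rewrite ?size_map ?size_iota // => lt_ip.
rewrite (nth_map 0) ?size_iota // nth_iota // add0n (nth_map v) //.
rewrite /edge (nth_map v) // nth_cat size_map size_cat /= addnS ltnS leq_addr.
rewrite (nth_map v) ?size_cat /= ?addnS ?ltnS ?leq_addr //.
by rewrite nth_cat ltnn subnn /= adj_sym.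
Qed.

(** Invariant of the enumeration: [p] is processed, [q] is numbered but not processed, and all
    neighbours of [p] are numbered. Induction on the number [f] of rows still to write. *)
Lemma tables_complete (G : sgraph) (f : nat) (p q : seq G) :
    cubic G -> uniq (p ++ q) -> size p + f = #|G| ->
    (forall v, v \in p -> forall u, adj v u -> u \in p ++ q) ->
  exists s : seq G, [/\ uniq s, size s = #|G| &
    partial_table s s \in
      tables #|G| f (size (p ++ q)) (partial_table (p ++ q) p)].
Proof.
move=> cubG; elim: f p q => [|f IHf] p q pq_uniq sz_p closed.
  have q0 : q = [::].
    apply/nilP; rewrite /nilp -leqn0 -(leq_add2l (size p)) sz_p -size_cat.
    by rewrite -(card_uniqP pq_uniq) max_card.
  exists p; move: pq_uniq; rewrite q0 cats0 => p_uniq.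
  by split; rewrite ?mem_seq1 // -sz_p addn0.
(* The next vertex [v] is the head of [q]. If [q] is empty, a union of components is finished and
   any unnumbered vertex takes the next number; hence the [maxn] in [tables]. *)
have [v [q' [pvq_uniq sub eqT eq_m]]] : exists v q',
    [/\ uniq (p ++ v :: q'), {subset p ++ q <= p ++ v :: q'},
    partial_table (p ++ q) p = partial_table (p ++ v :: q') p &
    maxn (size (p ++ q)) (size p).+1 = size (p ++ v :: q')].
  case: q => [|v q] in pq_uniq closed *; last first.
    exists v, q; split=> //; apply/maxn_idPl.
    by rewrite size_cat /= addnS ltnS leq_addr.
  rewrite cats0 in pq_uniq closed *.
  have [v pv|pT] := pickP [predC p]; last first.
    suff: size p = #|G| by lia.
    by rewrite -(card_uniqP pq_uniq); apply: eq_card => u; apply/negbFE/pT.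
  have {}pv : v \notin p by [].
  exists v, [::]; split.
  - by rewrite cats1 rcons_uniq pv.
  - by move=> u; rewrite mem_cat => ->.
  - by rewrite partial_table_cat // cats1 rcons_uniq pv.
  - by rewrite size_cat addn1; apply/maxn_idPr.
have closed' u : u \in p -> forall w, adj u w -> w \in p ++ v :: q'.
  by move=> pu w euw; apply/sub/(closed u).
rewrite {}eqT /= size_map eq_m partial_table_edge.
set s := p ++ v :: q' in pvq_uniq closed' *.
(* The unnumbered neighbours of [v] get the next free numbers; by cubicity there are [t] of them, in
   the notation of [tables]. *)
pose N := [seq u <- enum G | adj v u && (u \notin s)].
have sN_uniq : uniq (s ++ N).
  rewrite cat_uniq pvq_uniq filter_uniq ?enum_uniq // andbT.
  by apply/hasPn => u; rewrite mem_filter => /andP[/andP[_ ->]].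
have old_s : [seq adj v u | u <- p] ++ false :: [seq adj v u | u <- q']
           = [seq adj v u | u <- s].
  by rewrite map_cat /= adj_irrefl.
have deg_v : count (adj v) s + size N = 3.
  rewrite -(cubG v) /degree /degree_in -(cardsID [set u in s]); congr (_ + _).
    rewrite -size_filter -(card_uniqP (filter_uniq _ pvq_uniq)).
    by apply: eq_card => u; rewrite !inE mem_filter.
  rewrite /N -(card_uniqP (filter_uniq _ (enum_uniq G))).
  by apply: eq_card => u; rewrite !inE mem_filter mem_enum andbT andbC.
have sz_sN : size (s ++ N) <= #|G| by rewrite -(card_uniqP sN_uniq) max_card.
have eq_sN : rcons p v ++ q' ++ N = s ++ N by rewrite cat_rcons -catA.
have [||u|t [t_uniq sz_t]] := IHf (rcons p v) (q' ++ N); rewrite ?eq_sN //.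
- by rewrite size_rcons addSnnS.
- rewrite mem_rcons inE => /predU1P[->|pu] w euw; rewrite mem_cat; last first.
    by rewrite (closed' u).
  by rewrite mem_filter euw mem_enum /= andbT orbN.
move=> t_in; exists t; split=> //; apply/flatten_mapP.
exists [seq adj v u | u <- q'].
  by rewrite mem_bitseqs size_map size_cat /= addnS subSS addKn.
rewrite old_s count_map (eq_count (a2 := adj v)) // -deg_v leq_addr addKn.
rewrite -size_cat sz_sN.
suff <- : partial_table (s ++ N) (rcons p v)
   = rcons (partial_table s p) ([seq adj v u | u <- s] ++
       nseq (size N) true ++ nseq (#|G| - size (s ++ N)) false) by [].
rewrite -(partial_table_cat sN_uniq closed') [LHS]map_rcons; congr rcons.
rewrite map_cat -catA; congr (_ ++ (_ ++ _)).
rewrite -(size_map (adj v)); apply/all_pred1P/allP => _ /mapP[u + ->].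
by rewrite mem_filter => /andP[/andP[-> _] _].
Qed.

Lemma tabulates_partial_table (G : sgraph) (s : seq G) :
  uniq s -> size s = #|G| -> tabulates #|G| (partial_table s s) s.
Proof.
move=> s_uniq sz_s; split=> // x0 i j lti ltj.
by rewrite /edge (nth_map x0) ?sz_s // subnn cats0 (nth_map x0) ?sz_s.
Qed.

Lemma cubic_tabulated (G : sgraph) : cubic G ->
  exists2 g, g \in tables #|G| #|G| 0 [::] & exists s : seq G, tabulates #|G| g s.
Proof.
move=> cubG; have := @tables_complete G #|G| [::] [::] cubG.
case=> [//|//|//|s [s_uniq sz_s s_in]].
exists (partial_table s s); first exact: s_in.
by exists s; apply: tabulates_partial_table.
Qed.

(* Unlike [has], this stops at the first success under call by value. *)
Fixpoint lazy_has (T : Type) (a : pred T) (s : seq T) : bool :=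
  if s is x :: s' then if a x then true else lazy_has a s' else false.

Lemma lazy_hasE (T : Type) (a : pred T) s : lazy_has a s = has a s.
Proof. by elim: s => //= x s ->; case: (a x). Qed.

(** * Reduction to representatives up to isomorphism *)

Definition relabels (n : nat) (g h : table) (p : seq nat) : bool :=
  [&& uniq p, size p == n, all (ltn^~ n) p &
   all (fun i => all (fun j => edge g (nth 0 p i) (nth 0 p j) == edge h i j)
                     (iota 0 n)) (iota 0 n)].

Lemma tabulates_relabel (G : sgraph) n (g h : table) (p : seq nat) (s : seq G) :
  relabels n g h p -> tabulates n g s -> exists t : seq G, tabulates n h t.
Proof.
case/and4P=> p_uniq /eqP sz_p /allP ltp /allP gh [s_uniq sz_G sz_s adj_s].
have /card_gt0P[x0 _] := vertex_gt0 G.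
exists [seq nth x0 s i | i <- p]; split; rewrite ?size_map ?sz_p -?sz_G //.
  rewrite map_inj_in_uniq // => i j /ltp /= lti /ltp /= ltj /eqP.
  by rewrite nth_uniq ?sz_s // => /eqP.
move=> y0 i j lti ltj; rewrite !(nth_map 0) ?sz_p //.
rewrite adj_s; try by apply: ltp; rewrite mem_nth ?sz_p.
have [iP jP] : i \in iota 0 n /\ j \in iota 0 n by rewrite !mem_iota.
by have /allP/(_ j jP)/eqP := gh i iP.
Qed.

(* For each vertex, the numbers of vertices that an odd number of walks of length
   1, 2, 3, 4 leads to: an invariant that only serves to prune the search for an
   isomorphism. *)
Definition walk_parities (g : table) : seq (seq nat) :=
  let step x := [seq odd (count id (mask x r)) | r <- g] in
  [seq [seq count id x | x <- traject step r 4] | r <- g].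

Section RelabelSearch.

Variables (n : nat) (g h : table) (wg wh : seq (seq nat)).

(** Backtracking over the images of 0, 1, and so on; nested conditionals skip the later tests under
    call by value. The leaf rechecks everything by [relabels], so soundness is immediate, while a
    missed isomorphism would make two counts in [separated] collide. *)
Fixpoint search (fuel : nat) (p : seq nat) : bool :=
  if fuel is f.+1 then
    let k := size p in
    lazy_has (fun v =>
      if nth [::] wg v == nth [::] wh k then
        if v \notin p then
          if [seq edge g v j | j <- p] == take k (nth [::] h k)
          then search f (rcons p v) else false
        else false
      else false) (iota 0 n)
  else relabels n g h p.

Lemma search_sound f p : search f p -> exists q, relabels n g h q.
Proof.
elim: f p => [|f IHf] p /=; first by exists p.
by rewrite lazy_hasE => /hasP[v _]; do 3![case: ifP => // _]; apply: IHf.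
Qed.

End RelabelSearch.

Definition relabelable (n : nat) (g h : table) : bool :=
  search n g h (walk_parities g) (walk_parities h) n [::].

Fixpoint representatives (n : nat) (gs : seq table) : seq table :=
  if gs is g :: gs' then
    let hs := representatives n gs' in
    if lazy_has (relabelable n g) hs then hs else g :: hs
  else [::].

Lemma representativesP (G : sgraph) n (gs : seq table) g (s : seq G) :
    g \in gs -> tabulates n g s ->
  exists2 h, h \in representatives n gs & exists t : seq G, tabulates n h t.
Proof.
move=> + tab; elim: gs => //= g' gs IHgs; rewrite lazy_hasE inE.
case/predU1P=> [<-|/IHgs[h h_in [t tabh]]]; last first.
  by exists h; [case: ifP => // _; rewrite inE h_in orbT | exists t].
case: ifP => [/hasP[h h_in /search_sound[p gh]]|_].
  by exists h; rewrite // ; apply: tabulates_relabel gh tab.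
by exists g; [apply: mem_head | exists s].
Qed.

(** The bound [5 + 'C(n.+2, 2)] is the one that [csets_bound] gives for a connected graph of order
    [n + 1] with a vertex of degree at least 4. *)
Definition separated (n : nat) : bool :=
  let hs := representatives n (tables n n 0 [::]) in
  let cs := [seq num_connected n h | h <- hs] in
  uniq cs &&
  all (fun h => if connected_seq (edge h) (iota 0 n) then true
                else num_connected n h < 5 + 'C(n.+2, 2)) hs.

Lemma separated_le10 : all separated (iota 1 10).
Proof. by vm_compute. Qed.

Lemma cubic_representative (G : sgraph) : cubic G -> #|G| <= 10 ->
  exists2 h, h \in representatives #|G| (tables #|G| #|G| 0 [::]) &
             exists s : seq G, tabulates #|G| h s.
Proof.
move=> cubG leG; have [g g_in [s tab]] := cubic_tabulated cubG.
exact: representativesP g_in tab.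
Qed.

Lemma separated_order (G : sgraph) : #|G| <= 10 -> separated #|G|.
Proof.
move=> leG; apply: (allP separated_le10).
by rewrite mem_iota vertex_gt0.
Qed.

(** Both graphs have tables among the same representatives, whose counts are pairwise distinct, so
    equal counts give equal tables. *)
Lemma cubic_isomorphic (G H : sgraph) : cubic G -> cubic H ->
    #|G| <= 10 -> #|H| = #|G| ->
    #|[set S : {set H} | cset S]| = #|[set S : {set G} | cset S]| ->
  isomorphic H G.
Proof.
move=> cubG cubH leG eqHG eqT.
have [g g_in [s tabG]] := cubic_representative cubG leG.
have [|h h_in [t tabH]] := cubic_representative cubH; first by rewrite eqHG.
rewrite eqHG in h_in tabH.
suff eq_gh : g = h.
  by apply: tabulates_isomorphic tabH _; rewrite -eq_gh; apply: tabG.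
have /andP[c_uniq _] := separated_order leG.
rewrite (card_csets tabG) (card_csets tabH) in eqT.
apply/eqP; rewrite -(nth_index [::] g_in) -(nth_index [::] h_in).
rewrite nth_uniq ?index_mem ?(map_uniq c_uniq) //.
rewrite -(nth_uniq 0 _ _ c_uniq) ?size_map ?index_mem //.
by rewrite !(nth_map [::]) ?index_mem // !nth_index // eqT.
Qed.

Lemma disconnected_cubic_few (G : sgraph) : cubic G -> #|G| <= 10 ->
    ~~ cset [set: G] ->
  #|[set S : {set G} | cset S]| < 5 + 'C(#|G|.+2, 2).
Proof.
move=> cubG leG; have [g g_in [s tabG]] := cubic_representative cubG leG.
rewrite (connected_table tabG) (card_csets tabG) => disc.
have /andP[_ /allP/(_ g g_in)] := separated_order leG.
by rewrite (negPf disc).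
Qed.

(** * Exact alliances and the coefficients of the alliance polynomial *)

Section Alliances.

Variable G : sgraph.
Implicit Types (S : {set G}) (v : G) (k : int).

Local Open Scope ring_scope.

Definition index_at S v : int := (degree_in S v)%:Z - (degree_in (~: S) v)%:Z.

Lemma degree_inC S v : (degree_in S v + degree_in (~: S) v = degree v)%N.
Proof.
rewrite /degree /degree_in -(cardsID S [set u in setT | adj v u]).
by congr (_ + _)%N; apply: eq_card => u; rewrite !inE andbC.
Qed.

Lemma degree_le_max v : (degree v <= max_degree G)%N.
Proof. exact: (leq_bigmax v). Qed.

Lemma max_degree_attained : exists v : G, degree v = max_degree G.
Proof.
rewrite /max_degree; have [v ->] := bigop.eq_bigmax (@degree G) (vertex_gt0 G).
by exists v.
Qed.

Lemma max_degree_lt : (max_degree G < #|G|)%N.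
Proof.
have [w <-] := max_degree_attained.
rewrite -cardsT; apply: proper_card; rewrite properE subsetT /=.
by apply/subsetPn; exists w; rewrite !inE // adj_irrefl.
Qed.

Lemma index_at_range S v : - (max_degree G)%:Z <= index_at S v <= (max_degree G)%:Z.
Proof.
by rewrite /index_at; have := degree_inC S v; have := degree_le_max v; lia.
Qed.

Lemma index_of_onto k : - (max_degree G)%:Z <= k <= (max_degree G)%:Z ->
  exists i, @index_of G i = k.
Proof.
move=> k_range.
have lti : (absz (k + (max_degree G)%:Z)%R < (2 * max_degree G).+1)%N by lia.
by exists (Ordinal lti); rewrite /index_of /=; lia.
Qed.

Lemma index_of_inj : injective (@index_of G).
Proof. by move=> i j; rewrite /index_of => eq_ij; apply: ord_inj; lia. Qed.

(** The values of [index_at] always lie between [- max_degree] and [max_degree], so exactness just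
    says that [k] is their minimum over [S]. *)
Lemma exact_allianceP k S : exact_alliance k S <->
  [/\ cset S, {in S, forall v, k <= index_at S v} &
      exists2 v, v \in S & index_at S v = k].
Proof.
have defE j : cset S -> - (max_degree G)%:Z <= j <= (max_degree G)%:Z ->
    {in S, forall v, j <= index_at S v} -> defensive_alliance j S.
  case/andP=> S0 conS j_range leS; rewrite /defensive_alliance S0 conS j_range.
  by apply/forall_inP => v /leS; rewrite /index_at; lia.
split=> [/andP[/and4P[S0 conS k_range /forall_inP defS] /forallP maxS] | ].
  have csetS : cset S by rewrite /cset S0.
  have leS : {in S, forall v, k <= index_at S v}.
    by move=> v /defS; rewrite /index_at; lia.
  split=> //; have /set0Pn[v0 Sv0] := S0.
  have [v Sv minv] := @arg_minP _ _ _ v0 [in S] (index_at S) Sv0.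
  exists v => //; apply/eqP; rewrite eq_le leS // andbT.
  have [i defi] := index_of_onto (index_at_range S v).
  by have := maxS i; rewrite defi defE // index_at_range.
case=> csetS leS [v Sv idv].
rewrite /exact_alliance defE -?idv ?index_at_range //=; last by rewrite idv.
apply/forallP => i; apply/implyP => /and4P[_ _ _ /forall_inP/(_ v Sv)].
by rewrite /index_at; lia.
Qed.

Lemma exact_alliance_cset k S : exact_alliance k S -> cset S.
Proof. by case/exact_allianceP. Qed.

Lemma exact_alliance_uniq k j S : exact_alliance k S -> exact_alliance j S -> k = j.
Proof.
move=> /exact_allianceP[_ lek [v Sv kv]] /exact_allianceP[_ lej [w Sw jw]].
by apply/eqP; rewrite eq_le -{1}jw lek // -kv lej.
Qed.

Lemma exact_alliance_exists S : cset S ->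
  exists2 v, v \in S & exact_alliance (index_at S v) S.
Proof.
move=> csetS; have /andP[/set0Pn[v0 Sv0] _] := csetS.
have [v Sv minv] := @arg_minP _ _ _ v0 [in S] (index_at S) Sv0.
by exists v => //; apply/exact_allianceP; split=> //; exists v.
Qed.

Lemma exact_alliance_range k S : exact_alliance k S ->
  - (max_degree G)%:Z <= k <= (max_degree G)%:Z.
Proof. by case/andP => /and4P[]. Qed.

Lemma num_exact_gt0 k S : exact_alliance k S -> (0 < num_exact_alliances G k)%N.
Proof. by move=> exS; apply/card_gt0P; exists S; rewrite inE. Qed.

Lemma num_exact_exists k :
  (0 < num_exact_alliances G k)%N -> exists S, exact_alliance k S.
Proof. by case/card_gt0P => S; rewrite inE; exists S. Qed.

(** Distinct indices give distinct exponents, as [max_degree_lt] keeps these nonnegative under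
    [absz]. Outside the range of the sum both sides vanish. *)
Lemma coef_alliance_poly (e : nat) :
  (alliance_poly G)`_e = (num_exact_alliances G (e%:Z - #|G|%:Z))%:R.
Proof.
rewrite /alliance_poly coef_sum; set k := e%:Z - _.
have coefE i : ((num_exact_alliances G (@index_of G i))%:R *:
     'X^(absz ((graph_order G)%:Z + @index_of G i)) : {poly int})`_e
   = if @index_of G i == k then (num_exact_alliances G k)%:R else 0.
  rewrite coefZ coefXn; case: (eqVneq (index_of i) k) => [->|/eqP ne_ik].
    by rewrite /graph_order [e == _](_ : _ = true) ?mulr1 // /k; lia.
  rewrite [e == _](_ : _ = false) ?mulr0 //.
  have := max_degree_lt; move: ne_ik; rewrite /k /index_of /graph_order; lia.
rewrite (eq_bigr _ (fun i _ => coefE i)) -big_mkcond /=.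
have [/index_of_onto[i0 defk]|out] :=
  boolP (- (max_degree G)%:Z <= k <= (max_degree G)%:Z).
  rewrite (big_pred1 i0) // => i; rewrite -defk; exact: (inj_eq index_of_inj).
rewrite big_pred0 => [|i]; last first.
  apply: contraNF out => /eqP <-; rewrite /index_of; have := ltn_ord i; lia.
case: (posnP (num_exact_alliances G k)) => [-> //|/num_exact_exists[S]].
move/exact_alliance_range.
by rewrite (negPf out).
Qed.

(** Each connected set has exactly one exact index, so it is counted in exactly one coefficient. *)
Lemma alliance_poly_at1 : (alliance_poly G).[1] = #|[set S : {set G} | cset S]|%:R.
Proof.
rewrite /alliance_poly horner_sum.
under eq_bigr => i _ do rewrite hornerZ hornerXn expr1n mulr1 /num_exact_alliances.
rewrite -natr_sum; congr (_%:R); under eq_bigr => i _ do rewrite -sum1_card.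
rewrite -sum1_card.
rewrite (exchange_big_dep (mem [set S : {set G} | cset S])) /=; last first.
  by move=> i S _; rewrite !inE => /exact_alliance_cset.
apply: eq_bigr => S; rewrite inE => csetS.
have [v _ exS] := exact_alliance_exists csetS.
have [i0 defi] := index_of_onto (index_at_range S v).
rewrite (big_pred1 i0) // => i; rewrite inE.
apply/idP/eqP => [exi|->]; last by rewrite defi.
by apply: index_of_inj; rewrite defi; apply: exact_alliance_uniq exi exS.
Qed.

Lemma degree_in_eq0_cset S v : cset S -> v \in S -> degree_in S v = 0%N -> S = [set v].
Proof.
move=> csetS Sv /cards0_eq deg0; apply/eqP; rewrite eqEsubset sub1set Sv andbT.
apply/subsetP => u Su; rewrite inE.
have /connectP[[|w p]] := csetP Sv csetS u Su; first by move=> _ ->.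
case/andP=> /and3P[_ Sw evw] _ _; have: w \in set0 by rewrite -deg0 !inE Sw.
by rewrite inE.
Qed.

Lemma cset1 v : cset [set v].
Proof.
apply/(csetP (set11 v)) => u; rewrite inE => /eqP->; exact: connect0.
Qed.

Lemma exact_alliance1 v : exact_alliance (- (degree v)%:Z) [set v].
Proof.
have idv : index_at [set v] v = - (degree v)%:Z.
  rewrite -(degree_inC [set v] v) /index_at.
  suff -> : degree_in [set v] v = 0%N by lia.
  apply/eqP; rewrite cards_eq0; apply/eqP/setP => u; rewrite !inE.
  by case: eqP => // ->; rewrite adj_irrefl.
apply/exact_allianceP; split; first exact: cset1.
  by move=> u; rewrite inE => /eqP->; rewrite idv.
by exists v; rewrite ?set11.
Qed.

(** Index [- max_degree] at [v] forces [v] to have maximum degree and no neighbour in [S]; a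
    connected [S] is then the singleton of [v]. *)
Lemma num_exact_min :
  num_exact_alliances G (- (max_degree G)%:Z) =
  #|[set v : G | degree v == max_degree G]|.
Proof.
rewrite -(card_imset _ set1_inj); apply: eq_card => S; rewrite inE.
apply/idP/imsetP => [/exact_allianceP[csetS _ [v Sv idv]]|[v]]; last first.
  by rewrite inE => /eqP <- ->; apply: exact_alliance1.
have [deg_v lev] := (degree_inC S v, degree_le_max v); rewrite /index_at in idv.
exists v; first by rewrite inE; lia.
by apply: degree_in_eq0_cset => //; lia.
Qed.

End Alliances.

(** * A lower bound on the number of connected sets *)

Section Growth.

Variable G : sgraph.
Implicit Types (S X : {set G}) (u v x : G).

Lemma connect_inducedS S X : S \subset X ->
  forall u v, connect (induced S) u v -> connect (induced X) u v.
Proof.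
move=> /subsetP sSX u v; apply: connect_sub => {u v} u v /and3P[Su Sv euv].
by apply: connect1; rewrite /induced /= !sSX.
Qed.

Lemma cset_cross X S : cset X -> S \subset X -> S != set0 -> S != X ->
  exists u v, [/\ u \in S, v \in X :\: S & adj u v].
Proof.
move=> csetX /subsetP sSX /set0Pn[x Sx] neSX.
have [v Xv nSv] : exists2 v, v \in X & v \notin S.
  apply/subsetPn; apply: contra neSX => sXS.
  by rewrite eqEsubset sXS andbT; apply/subsetP.
have /connectP[p xp defv] := csetP (sSX x Sx) csetX v Xv.
elim: p x Sx xp defv => [|y p IHp] x Sx /= => [_ defv|/andP[/and3P[_ Xy exy] yp] defv].
  by rewrite defv Sx in nSv.
have [Sy|nSy] := boolP (y \in S); first exact: IHp yp defv.
by exists x, y; rewrite inE nSy.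
Qed.

Lemma cset_setU1 S u v : cset S -> u \in S -> adj u v -> cset (v |: S).
Proof.
move=> csetS Su euv; have USu : u \in v |: S by rewrite inE Su orbT.
apply/(csetP USu) => w; rewrite in_setU1 => /predU1P[->|Sw].
  by apply: connect1; rewrite /induced /= USu setU11.
exact: connect_inducedS (subsetUr _ _) _ _ (csetP Su csetS w Sw).
Qed.

Lemma cset_sub_card X v (k : nat) : cset X -> v \in X -> 0 < k <= #|X| ->
  exists S, [/\ S \subset X, v \in S, cset S & #|S| = k].
Proof.
move=> csetX Xv; elim: k => // -[_ _|k IHk /andP[_ ltkX]].
  by exists [set v]; rewrite sub1set set11 cards1 cset1.
have [|S [sSX Sv csetS sz_S]] := IHk; first exact: ltnW.
have [||u [w [Su]]] := cset_cross csetX sSX.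
- by apply/set0Pn; exists v.
- by apply: contraTneq ltkX => <-; rewrite sz_S ltnn.
rewrite inE => /andP[nSw Xw] euw; exists (w |: S); split.
- by rewrite subUset sub1set Xw.
- by rewrite inE Sv orbT.
- exact: cset_setU1 euw.
- by rewrite cardsU1 nSw sz_S.
Qed.

Definition csets_in X : {set {set G}} := [set S in powerset X | cset S].

(** Growing from [v] yields a connected subset containing [v] of each size from 1 to [#|X|.+1], and
    none of these lies in [X]. *)
Lemma card_csets_setU1 X u v : cset X -> u \in X -> v \notin X -> adj u v ->
  #|csets_in X| + #|X|.+1 <= #|csets_in (v |: X)|.
Proof.
move=> csetX Xu nXv euv; have csetvX := cset_setU1 csetX Xu euv.
have sz_vX : #|v |: X| = #|X|.+1 by rewrite cardsU1 nXv.
have exS (k : 'I_#|X|.+1) : exists S : {set G},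
    [&& S \subset v |: X, v \in S, cset S & #|S| == k.+1].
  have [|S [sS Sv csetS sz_S]] := @cset_sub_card _ v k.+1 csetvX (setU11 _ _).
    by rewrite sz_vX ltn_ord.
  by exists S; rewrite sS Sv csetS sz_S /=.
pose F k := xchoose (exS k).
have FP k := xchooseP (exS k).
have F_inj : injective F.
  move=> i j eqF; have /and4P[_ _ _ /eqP] := FP i; rewrite -/(F i) eqF.
  by have /and4P[_ _ _ /eqP->] := FP j => -[] /ord_inj.
rewrite -[X in _ + X]card_ord -(card_imset predT F_inj) -cardsUI.
rewrite [_ :&: _](_ : _ = set0) ?cards0 ?addn0; last first.
  apply/setP=> S; rewrite !inE.
  apply/andP => -[/andP[/subsetP sSX _] /imsetP[k _ defS]].
  have /and4P[_ + _ _] := FP k; rewrite -/(F k) -defS => /sSX.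
  by rewrite (negPf nXv).
apply: subset_leq_card; apply/subsetP => S; rewrite !inE => /orP[/andP[sSX ->]|].
  by rewrite andbT (subset_trans sSX) // subsetUr.
by case/imsetP=> k _ ->; have /and4P[-> _ -> _] := FP k.
Qed.

(** Add the missing vertices one at a time: each gain of [#|X|.+1] is the step from ['C(#|X|.+1, 2)]
    to ['C(#|X|.+2, 2)]. *)
Lemma csets_bound_setT X : cset [set: G] -> cset X ->
  5 + 'C(#|X|.+1, 2) <= #|csets_in X| ->
  5 + 'C(#|G|.+1, 2) <= #|[set S : {set G} | cset S]|.
Proof.
move=> csetT; have [n] := ubnP (#|G| - #|X|).
elim: n X => // n IHn X leX csetX boundX.
have [defX|neX] := eqVneq X setT.
  rewrite -cardsT -defX; apply: leq_trans boundX (subset_leq_card _).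
  by apply/subsetP => S; rewrite !inE => /andP[].
have X0 : X != set0 by case/andP: csetX.
have [u [v [Xu]]] := cset_cross csetT (subsetT X) X0 neX.
rewrite inE => /andP[nXv _] euv.
have sz_vX : #|v |: X| = #|X|.+1 by rewrite cardsU1 nXv.
apply: (IHn (v |: X)).
- have: #|v |: X| <= #|G| by apply: max_card.
  by rewrite sz_vX; lia.
- exact: cset_setU1 euv.
rewrite sz_vX; apply: leq_trans (card_csets_setU1 csetX Xu nXv euv).
by rewrite binS bin1 addnA leq_add2r.
Qed.

(* A vertex with four neighbours already gives 2 ^ 4 + 4 = 5 + 'C(6, 2)
   connected sets. *)
Lemma csets_bound v : cset [set: G] -> 3 < degree v ->
  5 + 'C(#|G|.+1, 2) <= #|[set S : {set G} | cset S]|.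
Proof.
move=> csetT deg_v.
have [B sB sz_B] : exists2 B : {set G}, B \subset [set u | adj v u] & #|B| = 4.
  have: 0 < 'C(#|[set u | adj v u]|, 4).
    rewrite bin_gt0; apply: leq_trans deg_v (subset_leq_card _).
    by apply/subsetP => u; rewrite !inE.
  rewrite -cards_draws => /card_gt0P[B]; rewrite inE => /andP[sB /eqP sz_B].
  by exists B.
have nBv : v \notin B by apply/negP => /(subsetP sB); rewrite inE adj_irrefl.
have star (D : {set G}) : D \subset B -> cset (v |: D).
  move=> /subsetP sDB; apply/(csetP (setU11 v D)) => u.
  rewrite in_setU1 => /predU1P[->|Du].
    exact: connect0.
  apply: connect1; rewrite /induced /= setU11 inE Du orbT /=.
  by have := subsetP sB u (sDB u Du); rewrite inE.
apply: (csets_bound_setT csetT (star B (subxx _))).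
rewrite cardsU1 nBv sz_B.
pose stars := [set v |: D | D : {set G} in powerset B].
pose leaves := [set [set u] | u in B].
have sz_stars : #|stars| = 16.
  rewrite card_in_imset ?card_powerset ?sz_B // => D E.
  rewrite !inE => sD sE eqDE.
  have nv (C : {set G}) : C \subset B -> v \notin C.
    by move=> /subsetP sC; apply: contra nBv => /sC.
  by rewrite -(setU1K (nv D sD)) eqDE setU1K ?nv.
have sz_leaves : #|leaves| = 4 by rewrite card_imset //; apply: set1_inj.
have disj : stars :&: leaves = set0.
  apply/setP => S; rewrite !inE; apply/andP => -[/imsetP[D _ ->] /imsetP[u Bu]].
  by move/setP/(_ v); rewrite setU11 inE => /esym/eqP defv; rewrite defv Bu in nBv.
rewrite -[5 + _]/(16 + 4) -sz_stars -sz_leaves -cardsUI disj cards0 addn0.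
apply: subset_leq_card; rewrite subUset; apply/andP; split; apply/subsetP => S.
  by case/imsetP=> D; rewrite !inE => sD ->; rewrite setUS ?star.
by case/imsetP=> u Bu ->; rewrite !inE cset1 andbT sub1set inE Bu orbT.
Qed.

End Growth.

(** * Graphs with fewer maximum-degree vertices than vertices *)

Section Components.

Variable G : sgraph.
Implicit Types (S : {set G}) (u v x : G).

Definition component S x : {set G} := [set v | connect (induced S) x v].

Lemma component_refl S x : x \in component S x.
Proof. by rewrite inE connect0. Qed.

Lemma component_sub S x : x \in S -> component S x \subset S.
Proof.
move=> Sx; apply/subsetP => v; rewrite inE => /connectP[p + ->].
elim: p x Sx => //= y p IHp x _ /andP[/and3P[_ Sy _]]; exact: IHp.
Qed.

Lemma component_closed S x u v :
  x \in S -> u \in component S x -> v \in S -> adj u v -> v \in component S x.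
Proof.
move=> Sx Cu Sv euv; have Su := subsetP (component_sub Sx) u Cu.
rewrite !inE in Cu *; apply: connect_trans Cu (connect1 _).
by rewrite /induced /= Su Sv.
Qed.

Lemma component_cset S x : x \in S -> cset (component S x).
Proof.
move=> Sx; apply/(csetP (component_refl S x)) => v; rewrite inE => /connectP[p xp ->].
have ind q z : z \in component S x -> path (induced S) z q ->
    path (induced (component S x)) z q.
  elim: q z => //= y q IHq z Cz /andP[/and3P[Sz Sy ezy] yq].
  have Cy := component_closed Sx Cz Sy ezy.
  by apply/andP; split; [apply/and3P | apply: IHq].
by apply/connectP; exists p => //; apply: ind xp; apply: component_refl.
Qed.

Lemma degree_in_component S x v : x \in S -> v \in component S x ->
  degree_in (component S x) v = degree_in S v.
Proof.
move=> Sx Cv; apply: eq_card => u; rewrite !in_set.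
have [evu|] := boolP (adj v u); last by rewrite !andbF.
rewrite !andbT; apply/idP/idP => [Cu|Su].
  by apply: (subsetP (component_sub Sx)); rewrite inE.
by have := component_closed Sx Cv Su evu; rewrite inE.
Qed.

(** No edge leaves a component of the whole graph. *)
Lemma index_at_component x v : v \in component setT x ->
  index_at (component setT x) v = (degree v)%:Z%R.
Proof.
move=> Cv; have := degree_inC (component setT x) v.
by rewrite /index_at (degree_in_component (in_setT x) Cv) /degree; lia.
Qed.

Lemma degree_in1 w v : degree_in [set w] v = adj v w.
Proof.
rewrite /degree_in; have [evw|nevw] := boolP (adj v w).
  apply/eqP/cards1P; exists w; apply/setP => u; rewrite !inE.
  by case: eqP => // ->; rewrite evw.
apply/eqP; rewrite cards_eq0; apply/eqP/setP => u; rewrite !inE.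
by case: eqP => // ->; rewrite (negPf nevw).
Qed.

End Components.

(** Here [m] stands for the excess of the order of [H] over that of the cubic graph. The last
    hypothesis puts [k + m] among -3, -1, 1, 3, the possible exact indices in a cubic graph. *)
Lemma few_defective_vertices (H : sgraph) (m : nat) :
    0 < m -> max_degree H = m + 3 ->
    #|[set v : H | degree v != max_degree H]| = m ->
    (forall (k : int) (S : {set H}), exact_alliance k S ->
       exists2 d : nat, d <= 3 & (k + m%:Z = 2 * d%:Z - 3)%R) ->
  [/\ cset [set: H], exists v : H, 3 < degree v &
      1 < num_exact_alliances H (3 - m%:Z)%R].
Proof.
move=> m_gt0 maxH defects indexP.
have defect_le (B : {set H}) : {in B, forall v, degree v < m + 3} -> #|B| <= m.
  move=> ltB; rewrite -[X in _ <= X]defects; apply: subset_leq_card.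
  by apply/subsetP => v /ltB ltv; rewrite inE maxH ltn_eqF.
have [x degx] := max_degree_attained H; rewrite maxH in degx.
have neq_x v : degree v != m + 3 -> x != v.
  by apply: contraNneq => <-; rewrite degx.
(* Singletons are exact alliances of index minus the degree, so all degrees are congruent to [m + 3]
   modulo 2. *)
have parity (v : H) : exists d : nat, m + 3 = degree v + 2 * d.
  by have [d led] := indexP _ _ (exact_alliance1 v); exists d; lia.
(* The exact index of a component is its minimum degree, hence at most [3 - m]. *)
have lowP (y : H) : exists z, [/\ z \in component setT y,
    exact_alliance (degree z)%:Z%R (component setT y), degree z + m <= 3 &
    {in component setT y, forall v, degree z <= degree v}].
  have [z Cz exC] := exact_alliance_exists (component_cset (in_setT y)).
  rewrite index_at_component // in exC; exists z; split=> // [|v Cv].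
    by have [d] := indexP _ _ exC; clear; lia.
  have /exact_allianceP[_ /(_ v Cv) + _] := exC.
  by rewrite index_at_component //.
have [w [Cw exC lew minw]] := lowP x; set C := component setT x in Cw exC minw.
have Cx : x \in C by apply: component_refl.
have neq_xw : x != w by apply: neq_x; move: lew m_gt0; clear; lia.
have degw_gt0 : 0 < degree w.
  rewrite lt0n; apply: contra neq_xw => /eqP degw0.
  have : degree_in C w = 0 by rewrite (degree_in_component (in_setT x) Cw).
  move/(degree_in_eq0_cset (component_cset (in_setT x)) Cw) => defC.
  by move: Cx; rewrite /C defC inE.
(* Parity leaves only [m = 1] with [degree w = 2] and [m = 2] with [degree w = 1]. *)
have degw : degree w + m = 3.
  by have [d] := parity w; move: lew m_gt0 degw_gt0; clear; lia.
have nwx : x \in ~: [set w] by rewrite !inE.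
pose D := component (~: [set w]) x.
have Dx : x \in D by apply: component_refl.
have csetD : cset D by apply: component_cset.
have nDw : w \notin D.
  by apply/negP => /(subsetP (component_sub nwx)); rewrite !inE eqxx.
have sDC : {subset D <= C}.
  by move=> v; rewrite !inE; apply: connect_inducedS; apply: subsetT.
have degD v : v \in D -> adj v w + degree_in D v = degree v.
  by move=> Dv; rewrite (degree_in_component nwx Dv) -degree_in1 degree_inC.
(* The only possible neighbour of [v] outside [D] is [w]. *)
have indexD v : v \in D -> (index_at D v = (degree v)%:Z - 2 * (adj v w)%:Z)%R.
  move=> Dv; have := degD v Dv; have := degree_inC D v.
  by rewrite /index_at; case: (adj v w); clear; lia.
have index_ge v : v \in D -> (3 - m%:Z <= index_at D v)%R.
  move=> Dv; rewrite indexD //; have := minw v (sDC v Dv).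
  have [evw|_] := boolP (adj v w); last by move: degw; clear; lia.
  (* A neighbour [v] of [w] loses 2, so its degree must exceed [3 - m]; by parity it is then at
     least [5 - m]. Otherwise [v] and [w] are two defects, so [m >= 2], whereas a neighbour of [v]
     in [D] besides [w] makes [degree v >= 2], so [m <= 1]. *)
  suff : degree v + m != 3.
    by have [d] := parity v; move: degw; clear; lia.
  apply/eqP => degv.
  have neq_xv : x != v by apply: neq_x; move: degv m_gt0; clear; lia.
  have degD0 : degree_in D v != 0.
    apply: contra neq_xv => /eqP/(degree_in_eq0_cset csetD Dv) defD.
    by move: Dx; rewrite defD inE.
  have := degD v Dv; rewrite evw => degDv.
  have : #|[set v; w]| <= m.
    apply: defect_le => u; rewrite !inE.
    by case/orP=> /eqP->; move: degv degw m_gt0; clear; lia.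
  rewrite cards2 (_ : v != w); last by apply: contraNneq nDw => <-.
  by move: degDv degD0 degv; clear; lia.
have [v Dv exD] := exact_alliance_exists csetD.
have topD : (index_at D v = 3 - m%:Z)%R.
  by have := index_ge v Dv; have [d] := indexP _ _ exD; clear; lia.
have neq_wv : w != v by apply: contraNneq nDw => ->.
split; last 1 first.
- have neCD : C != D by apply: contraNneq nDw => <-.
  apply: leq_trans (_ : #|[set C; D]| <= _); first by rewrite cards2 neCD.
  apply: subset_leq_card; apply/subsetP => S; rewrite !inE => /orP[]/eqP->.
    by rewrite (_ : (3 - m%:Z)%R = (degree w)%:Z%R) //; move: degw; clear; lia.
  by rewrite -topD.
(* If [z] were outside [C], the defects [z] and [w] would give [m = 2]. Then [v], of index [3 - m]
   in [D], has degree at most 3 and is a third defect. *)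
- have low_C z : degree z + m <= 3 -> z \in C.
    move=> lowz; apply: contraT => nCz.
    have neq u : u \in C -> z != u by move=> Cu; apply: contraNneq nCz => ->.
    have le2 : #|[set z; w]| <= m.
      apply: defect_le => u; rewrite !inE.
      by case/orP=> /eqP->; move: lowz lew m_gt0; clear; lia.
    rewrite cards2 (neq w Cw) in le2.
    have : #|z |: [set w; v]| <= m.
      apply: defect_le => u; rewrite !inE => /or3P[]/eqP->.
      - by move: lowz m_gt0; clear; lia.
      - by move: lew m_gt0; clear; lia.
      - by move: topD le2; rewrite indexD //; case: (adj v w); clear; lia.
    rewrite cardsU1 cards2 !inE negb_or (neq w Cw) (neq v (sDC v Dv)) neq_wv.
    by move: degw degw_gt0; clear; lia.
  apply/(csetP (in_setT x)) => y _; have [z [yz _ lowz _]] := lowP y.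
  have xz := low_C z lowz.
  rewrite !inE in xz yz; apply: connect_trans xz _.
  by rewrite induced_connect_sym.
- by exists x; rewrite degx; move: m_gt0; clear; lia.
Qed.

(** * Comparison of the two polynomials *)

(** Index 3 in a cubic graph means that no edge leaves [S], so connectedness leaves only the whole
    vertex set. *)
Lemma connected_cubic_num_exact3 (G : sgraph) : cubic G -> cset [set: G] ->
  num_exact_alliances G 3%R <= 1.
Proof.
move=> cubG csetT; rewrite -(cards1 [set: G]); apply: subset_leq_card.
apply/subsetP => S; rewrite !inE => /exact_allianceP[csetS le3 _].
apply: contraT => neS; have S0 : S != set0 by case/andP: csetS.
have [u [v [Su]]] := cset_cross csetT (subsetT S) S0 neS.
rewrite inE => /andP[nSv _] euv.
have := le3 u Su; rewrite /index_at; have := degree_inC S u; rewrite cubG.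
suff : 0 < degree_in (~: S) u by lia.
by apply/card_gt0P; exists v; rewrite !inE nSv.
Qed.

Theorem proposition3p5 (G : sgraph) (hcubic : cubic G)
    (horder : (graph_order G <= 10)%N)
    (G' : sgraph) (hpoly : alliance_poly G' = alliance_poly G) :
  isomorphic G' G.
Proof.
have total : #|[set S : {set G'} | cset S]| = #|[set S : {set G} | cset S]|.
  by apply/eqP; rewrite -(eqr_nat int) -!alliance_poly_at1 hpoly.
(* Equal exponents mean that index [k] in [G'] matches index [k + #|G'| - #|G|] in [G]. *)
have transfer (k : int) : (0 <= #|G'|%:Z + k)%R ->
    num_exact_alliances G' k = num_exact_alliances G (k + #|G'|%:Z - #|G|%:Z)%R.
  move=> k_ge.
  have := congr1 (fun p : {poly int} => p`_(absz (#|G'|%:Z + k)))%R hpoly.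
  rewrite !coef_alliance_poly => /eqP; rewrite eqr_nat => /eqP.
  rewrite (_ : Posz (absz _) - #|G'|%:Z = k)%R; last by lia.
  by rewrite (_ : Posz (absz _) - #|G|%:Z = k + #|G'|%:Z - #|G|%:Z)%R; last by lia.
have maxG : max_degree G = 3.
  by have [v <-] := max_degree_attained G.
have ltG := max_degree_lt G; have ltG' := max_degree_lt G'.
(* The lowest term of each polynomial occurs in the other, so their exponents agree; their
   coefficients count the vertices of maximum degree. *)
have [sz_max eq_max] :
    #|[set v : G' | degree v == max_degree G']| = #|G| /\
    max_degree G' + #|G| = #|G'| + 3.
  have minG : num_exact_alliances G (- (3%:Z))%R = #|G|.
    rewrite -maxG num_exact_min -cardsT; apply: eq_card => v.
    by rewrite !inE maxG hcubic.
  have [x degx] := max_degree_attained G'.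
  have exx := exact_alliance1 x; have := num_exact_gt0 exx.
  rewrite degx transfer; last by lia.
  case/num_exact_exists => S /exact_alliance_range; rewrite maxG => rangeS.
  have := transfer (#|G|%:Z - 3 - #|G'|%:Z)%R; rewrite subrK.
  have -> : (#|G|%:Z - 3 - #|G|%:Z = - (3%:Z))%R by lia.
  rewrite minG => /(_ ltac:(lia)) eqn.
  have: 0 < num_exact_alliances G' (#|G|%:Z - 3 - #|G'|%:Z)%R.
    by rewrite eqn vertex_gt0.
  case/num_exact_exists => S' /exact_alliance_range rangeS'.
  have eqmax : max_degree G' + #|G| = #|G'| + 3 by lia.
  split=> //; rewrite -num_exact_min -eqn; congr num_exact_alliances; lia.
have leGG' : #|G| <= #|G'| by rewrite -sz_max max_card.
have defects : #|[set v : G' | degree v != max_degree G']| = #|G'| - #|G|.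
  rewrite -sz_max -(cardsC [set v : G' | degree v == max_degree G']) addKn.
  by apply: eq_card => v; rewrite !inE.
have [eqG|neG] := eqVneq #|G'| #|G|.
  apply: cubic_isomorphic => // v; apply/eqP; apply: contraT => degv.
  have : v \in [set v : G' | degree v != max_degree G'] by rewrite inE; lia.
  have /cards0_eq-> : #|[set v : G' | degree v != max_degree G']| = 0.
    by rewrite defects eqG subnn.
  by rewrite inE.
have [||||csetG' [x degx] num_top] := @few_defective_vertices G' (#|G'| - #|G|).
- by lia.
- by lia.
- exact: defects.
- move=> k S exS; have /andP[rangeS _] := exact_alliance_range exS.
  have := num_exact_gt0 exS; rewrite transfer; last by lia.
  case/num_exact_exists => S' /exact_allianceP[_ _ [v _ idv]].
  have := degree_inC S' v; rewrite hcubic => degv.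
  (* In the cubic [G] the index at [v] is twice its degree in [S'] minus 3. *)
  by exists (degree_in S' v); move: idv; rewrite /index_at; lia.
have [csetG|discG] := boolP (cset [set: G]).
  have := connected_cubic_num_exact3 hcubic csetG.
  move: num_top; rewrite transfer; last by lia.
  have -> : (3 - (#|G'| - #|G|)%N%:Z + #|G'|%:Z - #|G|%:Z = 3 :> int)%R by lia.
  by rewrite ltnNge => /negPf->.
(* Since [#|G'| >= #|G| + 1], the lower bound for [G'] contradicts the upper bound for [G]. *)
have := disconnected_cubic_few hcubic horder discG.
rewrite -total ltnNge (leq_trans _ (csets_bound csetG' degx)) //.
by rewrite leq_add2l leq_bin2l //; lia.
Qed.
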